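(* Let $\mathcal{H}=\{\chi_{[0,t]} : t\in[0,1]\}\subset L^2([0,1])$. Then $$W_{(N,m)}(\mathcal{H})\asymp\frac{1}{\sqrt{Nm}},$$ i.e. there are absolute constants $C_1,C_2>0$ such that $\dfrac{C_1}{\sqrt{Nm}}\le W_{(N,m)}(\mathcal{H})\le\dfrac{C_2}{\sqrt{Nm}}$ for all integers $N,m\ge1$.
   Context: $\chi_E$ denotes the characteristic function of $E$. For a subset $A$ of a Banach space $\mathcal{X}$, Temlyakov's non-linear $(N,m)$-width is $$W_{(N,m)}(A)=\inf_{\mathcal{L}_N\subseteq\mathcal{L}(\mathcal{X})_m,\ |\mathcal{L}_N|=N}\ \sup_{f\in A}\ \inf_{L\in\mathcal{L}_N}\ \mathrm{dist}(f,L),$$ where $\mathcal{L}(\mathcal{X})_m$ is the collection of all $m$-dimensional linear subspaces of $\mathcal{X}$ and $\mathrm{dist}(f,L)$ is the distance from $f$ to $L$. Here $\mathcal{X}=L^2([0,1])$. *)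

(* Defs.v *)
From HB Require Import structures.
From mathcomp Require Import all_boot all_order all_algebra.
From mathcomp Require Import all_classical all_reals all_analysis.
From mathcomp Require Import measurable_realfun ess_sup_inf.

Set Implicit Arguments.
Unset Strict Implicit.
Unset Printing Implicit Defensive.

Import Order.TTheory GRing.Theory Num.Theory.
Import numFieldNormedType.Exports.

Local Open Scope classical_set_scope.
Local Open Scope ring_scope.

Lemma ae_eq_Lnorm d (T : measurableType d) (R : realType)
    (mu : {measure set T -> \bar R}) (p : \bar R) (f g : T -> R) :
  (1 <= p)%E -> measurable_fun setT f -> measurable_fun setT g ->
  ae_eq mu setT f g ->
  ('N[mu]_p[EFin \o f] = 'N[mu]_p[EFin \o g])%E.
Proof.
move=> p1 mf mg fg; rewrite unlock /Lnorm; case: p p1 => [r|_|//].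
- move=> _; congr (_ `^ _)%E; apply: ae_eq_integral => //.
  + apply: (measurableT_comp (measurable_poweR _) (g := abse \o (EFin \o f))) => /=.
    by apply: measurableT_comp => //; exact: measurableT_comp.
  + apply: (measurableT_comp (measurable_poweR _) (g := abse \o (EFin \o g))) => /=.
    by apply: measurableT_comp => //; exact: measurableT_comp.
  + by apply: filterS fg => x /(_ I) fgx _ /=; rewrite fgx.
- case: ifPn => // _; apply: eq_ess_sup.
  by apply: filterS fg => x /(_ I) fgx /=; rewrite fgx.
Qed.

(* The library gives LspaceType (a.e.-classes of functions with finite L^p norm)
   no algebraic or metric structure. It is made a normed module here, the
   operations and the norm being those of representatives. *)
Section Lspace_normedModType.
Context d (T : measurableType d) (R : realType).
Variables (mu : {measure set T -> \bar R}) (p : \bar R) (p1 : (1 <= p)%E).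

Local Notation Lf := (LfunType mu p1).
Local Notation Lp := (LspaceType mu p1).

Section repr.
Variable F : Lp.
Let f : T -> R := F.

HB.instance Definition _ := @isMeasurableFun.Build d _ T R f
  (@measurable_funPT _ _ _ _ (repr (LebesgueSpace.sort F))).
HB.instance Definition _ := @isLfunction.Build d T R mu p p1 f
  (@Lebesgue_finite _ _ _ _ _ _ F).

Definition Lfun_of_Lspace : Lf := [the LfunType mu p1 of f].
End repr.

Section class.
Variable f : Lf.
Let g : T -> measurableTypeR R := f.

HB.instance Definition _ := @isMeasurableFun.Build d _ T (measurableTypeR R) g
  (@measurable_funPT _ _ _ _ f).

Let g' : {mfun T >-> measurableTypeR R} :=
  [the {mfun T >-> measurableTypeR R} of g].

Let c : {mfun_ mu, T >-> measurableTypeR R} :=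
  (\pi_({mfun_ mu, T >-> measurableTypeR R}) g')%qT.

Let cE : ae_eq mu setT (c : T -> R) f.
Proof.
have /eqmodP/asboolP := reprK c.
by apply: filterS => x.
Qed.

Let c_finite : finite_norm mu p c.
Proof.
rewrite /finite_norm (ae_eq_Lnorm p1 _ _ cE)//; first exact: Lfunction_finite.
exact: (@measurable_funPT _ _ _ _ (repr c)).
Qed.

HB.instance Definition _ := @isFinLebesgue.Build d T R mu p p1 c c_finite.

Definition Lspace_of_Lfun : Lp := [the LspaceType mu p1 of c].

Lemma Lspace_of_LfunE : ae_eq mu setT (Lspace_of_Lfun : T -> R) f.
Proof. exact: cE. Qed.

End class.

Lemma Lspace_ae_eqP (F G : Lp) : ae_eq mu setT (F : T -> R) G -> F = G.
Proof.
case: F G => [F [[Ffin]]] [G [[Gfin]]] /= FG.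
have FGE : F = G.
  rewrite -[F]reprK -[G]reprK; apply/eqmodP/asboolP.
  by apply: filterS FG => x.
by case: G / FGE Gfin {FG} => Gfin; rewrite (Prop_irrelevance Ffin Gfin).
Qed.

HB.instance Definition _ := gen_eqMixin Lp.
HB.instance Definition _ := gen_choiceMixin Lp.

Local Notation Lfun_of := Lfun_of_Lspace.
Local Notation Lspace_of := Lspace_of_Lfun.

Definition Lspace_zero : Lp := Lspace_of 0.
Definition Lspace_opp (F : Lp) : Lp := Lspace_of (- Lfun_of F).
Definition Lspace_add (F G : Lp) : Lp := Lspace_of (Lfun_of F + Lfun_of G).
Definition Lspace_scale (a : R) (F : Lp) : Lp := Lspace_of (a *: Lfun_of F).

Let addE F G : ae_eq mu setT (Lspace_add F G : T -> R) (F \+ G).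
Proof. exact: Lspace_of_LfunE. Qed.

Let oppE F : ae_eq mu setT (Lspace_opp F : T -> R) (\- F).
Proof. exact: Lspace_of_LfunE. Qed.

Let zeroE : ae_eq mu setT (Lspace_zero : T -> R) (cst 0).
Proof. exact: Lspace_of_LfunE. Qed.

Let scaleE a F : ae_eq mu setT (Lspace_scale a F : T -> R) (fun x => a * F x).
Proof. exact: Lspace_of_LfunE. Qed.

Let aeI (P Q : T -> Prop) :
  (\forall x \ae mu, P x) -> (\forall x \ae mu, Q x) ->
  \forall x \ae mu, P x /\ Q x.
Proof. by apply: filterS2 => x; split. Qed.

Let addA : associative Lspace_add.
Proof.
move=> F G H; apply: Lspace_ae_eqP.
have h := aeI (aeI (addE F (Lspace_add G H)) (addE G H))
  (aeI (addE (Lspace_add F G) H) (addE F G)).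
apply: filterS h => x [[/(_ I) e1 /(_ I) e2] [/(_ I) e3 /(_ I) e4]] _.
rewrite e1 e3 /= e2 e4 /=.
exact: addrA.
Qed.

Let addC : commutative Lspace_add.
Proof.
move=> F G; apply: Lspace_ae_eqP; move: (addE F G) (addE G F).
apply: filterS2 => x /(_ I) + /(_ I) + _ => /= -> ->.
exact: addrC.
Qed.

Let add0 : left_id Lspace_zero Lspace_add.
Proof.
move=> F; apply: Lspace_ae_eqP; move: (addE Lspace_zero F) zeroE.
apply: filterS2 => x /(_ I) + /(_ I) + _ => /= -> ->.
exact: add0r.
Qed.

Let addN : left_inverse Lspace_zero Lspace_opp Lspace_add.
Proof.
move=> F; apply: Lspace_ae_eqP; move: (addE (Lspace_opp F) F) (oppE F) zeroE.
apply: filterS3 => x /(_ I) + /(_ I) + /(_ I) + _ => /= -> -> ->.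
exact: addNr.
Qed.

HB.instance Definition _ := GRing.isZmodule.Build Lp addA addC add0 addN.

Let scaleA a b F :
  Lspace_scale a (Lspace_scale b F) = Lspace_scale (a * b) F.
Proof.
apply: Lspace_ae_eqP.
move: (scaleE a (Lspace_scale b F)) (scaleE b F) (scaleE (a * b) F).
apply: filterS3 => x /(_ I) + /(_ I) + /(_ I) + _ => /= -> -> ->.
exact: mulrA.
Qed.

Let scale1 : left_id 1 Lspace_scale.
Proof.
move=> F; apply: Lspace_ae_eqP; move: (scaleE 1 F).
by apply: filterS => x /(_ I) + _ => /= ->; exact: mul1r.
Qed.

Let scaleDr : right_distributive Lspace_scale +%R.
Proof.
move=> a F G; apply: Lspace_ae_eqP.
have h := aeI (aeI (scaleE a (F + G)) (addE F G))
  (aeI (addE (Lspace_scale a F) (Lspace_scale a G))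
    (aeI (scaleE a F) (scaleE a G))).
apply: filterS h => x.
move=> [[/(_ I) e1 /(_ I) e2] [/(_ I) e3 [/(_ I) e4 /(_ I) e5]]] _.
by rewrite e1 e2 e3 /= e4 e5; exact: mulrDr.
Qed.

Let scaleDl F : {morph Lspace_scale^~ F : a b / a + b}.
Proof.
move=> a b; apply: Lspace_ae_eqP.
have h := aeI (aeI (scaleE (a + b) F)
    (addE (Lspace_scale a F) (Lspace_scale b F)))
  (aeI (scaleE a F) (scaleE b F)).
apply: filterS h => x [[/(_ I) e1 /(_ I) e2] [/(_ I) e3 /(_ I) e4]] _.
by rewrite e1 e2 /= e3 e4; exact: mulrDl.
Qed.

HB.instance Definition _ :=
  GRing.Zmodule_isLmodule.Build R Lp scaleA scale1 scaleDr scaleDl.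

Lemma Lspace0E : ae_eq mu setT ((0 : Lp) : T -> R) (cst 0).
Proof. exact: zeroE. Qed.

Lemma LspaceDE (F G : Lp) : ae_eq mu setT (F + G : T -> R) (F \+ G).
Proof. exact: addE. Qed.

Lemma LspaceZE a (F : Lp) : ae_eq mu setT (a *: F : T -> R) (fun x => a * F x).
Proof. exact: scaleE. Qed.

Definition Lspace_norm (F : Lp) : R := fine ('N[mu]_p[EFin \o F])%E.

Let Lspace_normE (f : Lf) (F : Lp) : ae_eq mu setT (F : T -> R) f ->
  Lspace_norm F = fine ('N[mu]_p[EFin \o f])%E.
Proof.
by move=> Ff; congr fine; exact: ae_eq_Lnorm.
Qed.

Let Lspace_normD F G : Lspace_norm (F + G) <= Lspace_norm F + Lspace_norm G.
Proof.
rewrite (@Lspace_normE (Lfun_of F + Lfun_of G)); last exact: LspaceDE.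
exact: ler_LnormD.
Qed.

Let Lspace_normZ a F : Lspace_norm (a *: F) = `|a| * Lspace_norm F.
Proof.
rewrite (@Lspace_normE (a *: Lfun_of F)); last exact: LspaceZE.
apply: EFin_inj.
rewrite EFinM finite_norm_fine.
rewrite (finite_norm_fine (Lfun_of F)).
exact: (LnormZ (Lfun_of F) a).
Qed.

Let Lspace_norm0_eq0 F : Lspace_norm F = 0 -> F = 0.
Proof.
move=> /(@fine_Lnormr_eq0 _ _ _ _ _ _ (Lfun_of F)) F0.
apply: Lspace_ae_eqP; move: F0 Lspace0E.
by apply: filterS2 => x /(_ I) + /(_ I) + _ => -> ->.
Qed.

HB.instance Definition _ := Lmodule_isNormed.Build R Lp
  Lspace_normD Lspace_normZ Lspace_norm0_eq0.

Lemma Lspace_normrE (F : Lp) : `|F| = fine ('N[mu]_p[EFin \o F])%E.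
Proof. by []. Qed.

End Lspace_normedModType.

Section width.
Context (R : realType) (X : normedModType R).

Lemma edist_norm (x y : X) : edist (x, y) = `|x - y|%:E.
Proof.
apply/eqP; rewrite eq_le; apply/andP; split.
- apply/lee_addgt0Pr => e e0; rewrite -EFinD; apply: edist_fin => /=.
    by rewrite ltr_wpDl.
  by rewrite -ball_normE /= ltrDl.
- apply: le_ereal_inf_tmp => _ [r [r0 /=]] /[swap] <-.
  by rewrite -ball_normE /= lee_fin => /ltW.
Qed.

Lemma edist_infE (L : set X) (f : X) :
  edist_inf L f = ereal_inf [set `|f - g|%:E | g in L].
Proof.
by congr ereal_inf; apply: eq_imagel => g _; exact: edist_norm.
Qed.

(* [lin_indep] and [lin_span] replace the [free] and [span] of vector.v, which
   require the ambient space to be finite-dimensional. *)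
Definition lin_indep m (b : 'I_m -> X) : Prop :=
  forall c : 'I_m -> R, \sum_(i < m) c i *: b i = 0 -> forall i, c i = 0.

Definition lin_span m (b : 'I_m -> X) : set X :=
  [set \sum_(i < m) c i *: b i | c in [set: 'I_m -> R]].

Definition subspaces_of_dim (m : nat) : set (set X) :=
  [set L | exists2 b : 'I_m -> X, lin_indep b & L = lin_span b].

(* Completeness of X plays no role. All bounds are taken in the extended reals,
   so that infima and suprema always exist. *)
Definition temlyakov_width (N m : nat) (A : set X) : \bar R :=
  ereal_inf
    [set ereal_sup [set ereal_inf [set edist_inf L f | L in LN] | f in A]
    | LN in [set LN : set (set X) |
              LN `<=` subspaces_of_dim m /\ (LN #= `I_N)%card]].

End width.

(* Functions live on the whole line; values off [0,1] are irrelevant because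
   the a.e. classes and norms are those of Lebesgue measure restricted to
   [0,1]. *)
Definition lebesgue01 (R : realType) :
    {measure set (measurableTypeR R) -> \bar R} :=
  mrestr lebesgue_measure (@measurable_itv R `[0, 1]).

Notation L2_01 R := (LspaceType2 (lebesgue01 R)).

Lemma lebesgue01_lty (R : realType) (E : set (measurableTypeR R)) :
  measurable E -> (lebesgue01 R E < +oo)%E.
Proof.
move=> mE; apply: (@le_lt_trans _ _ (@lebesgue_measure R `[0, 1])).
  rewrite -[leLHS]/(@lebesgue_measure R (E `&` `[0, 1])).
  apply: le_measure; rewrite ?inE//.
  by apply: measurableI => //; exact: measurable_itv.
by rewrite lebesgue_measure_itv /= lte_fin ltr01 -EFinD ltry.
Qed.

Lemma indic_Lfun2 (R : realType) (E : set (measurableTypeR R)) :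
  measurable E -> (\1_E : measurableTypeR R -> R) \in Lfun (lebesgue01 R) 2%:E.
Proof.
move=> mE; rewrite inE; apply/andP; split; rewrite inE /=.
  exact: measurable_indic.
rewrite /finite_norm unlock /Lnorm poweR_lty//.
rewrite (eq_integral (fun x => (\1_E x)%:E)).
  by rewrite integral_indic// setIT lebesgue01_lty.
move=> x _ /=; rewrite indicE; case: (x \in E) => /=.
  by rewrite normr1 powR1.
by rewrite normr0 powR0// pnatr_eq0.
Qed.

Definition chi (R : realType) (E : set (measurableTypeR R))
    (mE : measurable E) : L2_01 R :=
  Lspace_of_Lfun (Lfun_Sub (lee1n 2) (indic_Lfun2 mE)).

Lemma chiE (R : realType) (E : set (measurableTypeR R)) (mE : measurable E) :
  ae_eq (lebesgue01 R) setT (chi mE : measurableTypeR R -> R) \1_E.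
Proof. exact: Lspace_of_LfunE. Qed.

Definition initial_segment_indicators (R : realType) : set (L2_01 R) :=
  [set chi (@measurable_itv R `[0, t]) | t in `[0, 1]].

(* Main.v *)
Require Import Defs.
From HB Require Import structures.
From mathcomp Require Import all_boot all_order all_algebra.
From mathcomp Require Import all_classical all_reals all_analysis.
From mathcomp Require Import measurable_realfun ring lra.

(** Write X_t for the class of the indicator of [0,t].  Everything takes place
    in the Hilbert structure of L^2: the inner product of X_s and X_t is
    min(s, t), so that |X_s - X_t|^2 = |s - t|, and increments of X over
    non-overlapping intervals are orthogonal.

    Upper bound.  Cut [0,1] into N * m cells.  The X_s at the right endpoints s
    of the cells, taken in N consecutive groups of m, span N subspaces of
    dimension m, and each t lies within 1/(N m) of some right endpoint s, so
    X_t is within 1/sqrt(N m) of one of the subspaces ([width_le]).  The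
    subspaces are of full dimension and distinct because second differences of
    X at the grid points are dual to the X_s
    ([segchi_second_difference]).

    Lower bound.  Suppose that N subspaces of dimension m approximate all X_t
    to within rho.  Among 3 N m equally spaced points t, some 3 m share the same
    subspace L ([pigeonhole_count]).  The first 2 m + 1 of them give 2 m
    orthogonal increments, each of squared norm at least 1/(3 N m) and at
    distance at most 2 rho from L.  But n orthonormal vectors cannot all be
    close to a subspace of dimension m < n: the sum of their squared distances
    to it is at least n - m ([orthonormal_span_dist]).  Hence
    1/(3 N m) * m <= 2 m * (2 rho)^2, that is 1 <= 24 rho^2 N m ([width_ge]).

    By Bessel's inequality, the fact on orthonormal vectors reduces to one on
    matrices: a square matrix H of size n and rank at most m is at squared
    Frobenius distance at least n - m from the identity
    ([frobenius_rank_dist]). *)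

Set Implicit Arguments.
Unset Strict Implicit.
Unset Printing Implicit Defensive.

Import Order.TTheory GRing.Theory Num.Theory.
Import numFieldNormedType.Exports.

Local Open Scope classical_set_scope.
Local Open Scope ring_scope.

(** * Distance from the identity to matrices of small rank *)

Lemma mxtrace_tr_mul (R : comRingType) m n (A B : 'M[R]_(m, n)) :
  \tr (A *m B^T) = \sum_i \sum_j A i j * B i j.
Proof.
apply: eq_bigr => i _; rewrite mxE; apply: eq_bigr => j _; by rewrite mxE.
Qed.

(** Gram matrices of linearly independent rows are invertible: v A A^T = 0
    implies |v A|^2 = 0. *)
Lemma mulmx_tr_unit (R : realFieldType) k n (A : 'M[R]_(k, n)) :
  row_free A -> A *m A^T \in unitmx.
Proof.
move=> fA; rewrite -row_free_unit -kermx_eq0; apply/eqP/row_matrixP => i.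
rewrite row0; set v := row i _.
have v0 : v *m (A *m A^T) = 0 by rewrite -row_mul mulmx_ker row0.
have : \tr ((v *m A) *m (v *m A)^T) = 0.
  by rewrite trmx_mul !mulmxA -(mulmxA v) v0 mul0mx mxtrace0.
rewrite mxtrace_tr_mul big_ord1 => /eqP; rewrite psumr_eq0; last first.
  by move=> j _; rewrite -expr2 sqr_ge0.
move=> /allP w0; have vA0 : v *m A = 0.
  apply/rowP => j; rewrite [RHS]mxE; apply/eqP; rewrite -sqrf_eq0 expr2.
  by apply: w0; rewrite mem_index_enum.
by apply/eqP; rewrite -(mulmx_free_eq0 _ fA) vA0.
Qed.

(** The trace of Q (1 - H), with Q the orthogonal projection onto the left
    kernel of H, is the dimension r >= n - m of that kernel, since Q H = 0; as Q
    has squared Frobenius norm r, expanding |(1 - H) - Q|^2 >= 0 gives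
    |1 - H|^2 >= 2 r - r = r. *)
Lemma frobenius_rank_dist (R : realFieldType) n m (H : 'M[R]_n) :
  (\rank H <= m)%N ->
  n%:R - m%:R <= \sum_i \sum_j (1%:M - H) i j ^+ 2.
Proof.
move=> rH; set A := row_base (kermx H).
have AH : A *m H = 0.
  apply/eqP; rewrite -sub_kermx; by rewrite eq_row_base.
have fA : row_free A by exact: row_base_free.
clearbody A; have uA := mulmx_tr_unit fA.
(* Q is the orthogonal projection onto the row space of A. *)
set S := invmx (A *m A^T); pose Q := A^T *m S *m A.
have QT : Q^T = Q.
  by rewrite /Q !trmx_mul trmxK mulmxA /S trmx_inv trmx_mul trmxK.
have QQ : Q *m Q = Q.
  by rewrite /Q -!mulmxA (mulmxA A) (mulmxA (A *m A^T)) mulmxV// mul1mx.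
set r := \rank (kermx H).
have trQ : \tr Q = r%:R.
  by rewrite /Q -mulmxA mxtrace_mulC -mulmxA mulVmx// mxtrace1.
have QH : Q *m H = 0 by rewrite /Q -mulmxA AH mulmx0.
have E1 : \tr (Q *m (1%:M - H)) = r%:R by rewrite mulmxBr QH subr0 mulmx1.
have E2 : \tr (Q *m Q^T) = r%:R by rewrite QT QQ.
set D := 1%:M - H in E1 *.
have E3 : \tr (D *m Q^T) = r%:R by rewrite QT mxtrace_mulC.
have : 0 <= \sum_i \sum_j (D i j - Q i j) ^+ 2.
  by apply: sumr_ge0 => i _; apply: sumr_ge0 => j _; exact: sqr_ge0.
have -> : \sum_i \sum_j (D i j - Q i j) ^+ 2 =
  \sum_i \sum_j D i j ^+ 2 - \tr (D *m Q^T) *+ 2 + \tr (Q *m Q^T).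
  rewrite !mxtrace_tr_mul -sumrMnl -sumrB -big_split/=; apply: eq_bigr => i _.
  rewrite -sumrMnl -sumrB -big_split/=; apply: eq_bigr => j _.
  by rewrite sqrrB (expr2 (Q i j)).
rewrite E2 E3 mulr2n => h.
have : n%:R - m%:R <= r%:R :> R.
  by rewrite lerBlDr -natrD ler_nat /r mxrank_ker addnC -leq_subLR leq_sub2l.
lra.
Qed.

(** * Linear spans *)

Section linear_span.
Context (R : realType) (X : normedModType R).

Lemma lin_span_mem m (b : 'I_m -> X) i : lin_span b (b i).
Proof.
exists (fun j => (j == i)%:R) => //.
rewrite (bigD1 i)//= eqxx scale1r big1 ?addr0// => j /negbTE->.
exact: scale0r.
Qed.

Lemma lin_spanZ m (b : 'I_m -> X) a F : lin_span b F -> lin_span b (a *: F).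
Proof.
move=> [c _ <-]; exists (fun i => a * c i) => //.
by rewrite scaler_sumr; apply: eq_bigr => i _; rewrite scalerA.
Qed.

Lemma lin_spanB m (b : 'I_m -> X) F G :
  lin_span b F -> lin_span b G -> lin_span b (F - G).
Proof.
move=> [c _ <-] [c' _ <-]; exists (fun i => c i - c' i) => //.
by rewrite -sumrB; apply: eq_bigr => i _; rewrite scalerBl.
Qed.

End linear_span.

(** * The inner product of L^2 *)

Section inner_product.
Context d (T : measurableType d) (R : realType).
Variable mu : {measure set T -> \bar R}.
Local Notation L2 := (LspaceType2 mu).

(** The inner product of L^2, computed on representatives. *)
Definition inner (F G : L2) : R := \int[mu]_x ((F x : R) * (G x : R)).

Lemma L2_measurable (F : L2) : measurable_fun setT (F : T -> R).
Proof. exact: (@measurable_funPT _ _ _ _ (repr (LebesgueSpace.sort F))). Qed.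

Lemma L2_Lfun (F : L2) : (F : T -> R) \in Lfun mu 2%:E.
Proof. exact: (LfunP (Lfun_of_Lspace F)). Qed.

Lemma L2_mul_integrable (F G : L2) :
  mu.-integrable setT (EFin \o (fun x => (F x : R) * (G x : R))).
Proof. exact/Lfun1_integrable/(Lfun2_mul_Lfun1 (L2_Lfun F) (L2_Lfun G)). Qed.

(** The inner product may be computed with any measurable representatives. *)
Lemma inner_ae (F G : L2) (f g : T -> R) :
  measurable_fun setT f -> measurable_fun setT g ->
  ae_eq mu setT (F : T -> R) f -> ae_eq mu setT (G : T -> R) g ->
  inner F G = \int[mu]_x (f x * g x).
Proof.
move=> mf mg Ff Gg; congr fine; apply: ae_eq_integral => //.
- by apply/measurable_EFinP; apply: measurable_funM; exact: L2_measurable.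
- by apply/measurable_EFinP; apply: measurable_funM.
by move: Ff Gg; apply: filterS2 => x /(_ I) Fx /(_ I) Gx _ /=; rewrite Fx Gx.
Qed.

Lemma innerC (F G : L2) : inner F G = inner G F.
Proof. by apply: eq_Rintegral => x _; rewrite mulrC. Qed.

Lemma innerDl (F G H : L2) : inner (F + G) H = inner F H + inner G H.
Proof.
rewrite (@inner_ae _ _ (F \+ G) H)//.
- rewrite -RintegralD//; [|exact: L2_mul_integrable|exact: L2_mul_integrable].
  by apply: eq_Rintegral => x _ /=; rewrite mulrDl.
- exact: LspaceDE.
- exact: ae_eq_refl.
Qed.

Lemma innerZl a (F G : L2) : inner (a *: F) G = a * inner F G.
Proof.
rewrite (@inner_ae _ _ (fun x => a * F x) G)//.
- rewrite -RintegralZl//; last exact: L2_mul_integrable.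
  by apply: eq_Rintegral => x _ /=; rewrite mulrA.
- by apply: measurable_funM => //; exact: L2_measurable.
- exact: LspaceZE.
- exact: ae_eq_refl.
Qed.

Lemma inner_norm (F : L2) : inner F F = `|F| ^+ 2.
Proof.
rewrite Lspace_normrE; apply: EFin_inj.
rewrite -powR_mulrn//; last exact: fine_ge0 (Lnorm_ge0 _ _ _).
rewrite -poweR_EFin (finite_norm_fine (Lfun_of_Lspace F)) poweR_Lnorm//.
rewrite fineK; last exact/integrable_fin_num/L2_mul_integrable.
apply: eq_integral => x _ /=.
by rewrite powR_mulrn// -normrX ger0_norm ?sqr_ge0.
Qed.

Lemma innerBl (F G H : L2) : inner (F - G) H = inner F H - inner G H.
Proof. by rewrite innerDl -scaleN1r innerZl mulN1r. Qed.

Lemma innerDr (F G H : L2) : inner F (G + H) = inner F G + inner F H.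
Proof. by rewrite innerC innerDl !(innerC F). Qed.

Lemma innerBr (F G H : L2) : inner F (G - H) = inner F G - inner F H.
Proof. by rewrite innerC innerBl !(innerC F). Qed.

Lemma innerZr a (F G : L2) : inner F (a *: G) = a * inner F G.
Proof. by rewrite innerC innerZl (innerC F). Qed.

Lemma inner0l (F : L2) : inner 0 F = 0.
Proof. by rewrite -(scale0r 0) innerZl mul0r. Qed.

Lemma inner_suml n (c : 'I_n -> R) (b : 'I_n -> L2) (F : L2) :
  inner (\sum_(i < n) c i *: b i) F = \sum_(i < n) c i * inner (b i) F.
Proof.
elim/big_ind2 : _ => [|x1 x2 y1 y2 <- <-|i _]; first exact: inner0l.
  by rewrite innerDl.
by rewrite innerZl.
Qed.

Lemma inner_sumr n (c : 'I_n -> R) (b : 'I_n -> L2) (F : L2) :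
  inner F (\sum_(i < n) c i *: b i) = \sum_(i < n) c i * inner F (b i).
Proof. by rewrite innerC inner_suml; apply: eq_bigr => i _; rewrite innerC. Qed.

Lemma bessel n (g : 'I_n -> L2) (F : L2) :
  (forall i j, inner (g i) (g j) = (i == j)%:R) ->
  \sum_(i < n) inner F (g i) ^+ 2 <= `|F| ^+ 2.
Proof.
move=> og; pose P := \sum_(i < n) inner F (g i) *: g i.
have FP : inner F P = \sum_(i < n) inner F (g i) ^+ 2.
  by rewrite inner_sumr; apply: eq_bigr => i _; rewrite expr2.
have PP : inner P P = \sum_(i < n) inner F (g i) ^+ 2.
  rewrite {1}/P inner_suml; apply: eq_bigr => i _; rewrite expr2; congr (_ * _).
  rewrite inner_sumr (bigD1 i)//= og eqxx mulr1 big1 ?addr0// => j ji.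
  by rewrite og eq_sym (negbTE ji) mulr0.
have : 0 <= `|F - P| ^+ 2 by exact: sqr_ge0.
rewrite -inner_norm innerBl !innerBr (innerC P) PP FP inner_norm; lra.
Qed.

(** In coordinates with respect to [g], the vectors [h i] form a matrix of rank
    at most [m], while the [g i] form the identity matrix. *)
Lemma orthonormal_span_dist n m (g : 'I_n -> L2) (b : 'I_m -> L2)
    (h : 'I_n -> L2) (e : R) :
  (forall i j, inner (g i) (g j) = (i == j)%:R) ->
  (forall i, lin_span b (h i)) -> (forall i, `|g i - h i| ^+ 2 <= e) ->
  n%:R - m%:R <= n%:R * e.
Proof.
move=> og hb gh.
(* The coordinates of the [h i] with respect to [g]. *)
pose H : 'M[R]_n := \matrix_(i, j) inner (h i) (g j).
have [c hc] : exists c : 'I_n -> 'I_m -> R,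
    forall i, h i = \sum_(k < m) c i k *: b k.
  have /choice [c hc] : forall i, exists c : 'I_m -> R,
      h i = \sum_(k < m) c k *: b k.
    by move=> i; have [c _ hc] := hb i; exists c.
  by exists c.
have rH : (\rank H <= m)%N.
  have -> : H = (\matrix_(i, k) c i k) *m (\matrix_(k, j) inner (b k) (g j)).
    apply/matrixP => i j; rewrite !mxE hc inner_suml.
    by apply: eq_bigr => k _; rewrite !mxE.
  exact: leq_trans (mxrankM_maxl _ _) (rank_leq_col _).
apply: le_trans (frobenius_rank_dist rH) _.
rewrite mulr_natl -[X in _ *+ X]card_ord -sumr_const; apply: ler_sum => i _.
apply: le_trans (gh i); apply: le_trans (bessel (g i - h i) og).
by apply: ler_sum => j _; rewrite !mxE innerBl og.
Qed.

(** The orthonormal case applies to the normalized [g i]. *)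
Lemma orthogonal_span_dist n m (g : 'I_n -> L2) (b : 'I_m -> L2)
    (h : 'I_n -> L2) (delta e : R) : 0 < delta ->
  (forall i j, i != j -> inner (g i) (g j) = 0) ->
  (forall i, delta <= `|g i| ^+ 2) ->
  (forall i, lin_span b (h i)) -> (forall i, `|g i - h i| ^+ 2 <= e) ->
  delta * (n%:R - m%:R) <= n%:R * e.
Proof.
move=> d0 og gd hb gh.
have g0 i : `|g i| != 0.
  by rewrite -(@sqrf_eq0 R) gt_eqF// (lt_le_trans d0).
rewrite mulrC -ler_pdivlMr// -mulrA.
apply: (@orthonormal_span_dist _ _ (fun i => `|g i|^-1 *: g i) b
  (fun i => `|g i|^-1 *: h i)).
- move=> i j; rewrite innerZl innerZr; have [<-|ij] := eqVneq i j.
    by rewrite inner_norm expr2 mulKf ?mulVf.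
  by rewrite og// !mulr0.
- by move=> i; exact: lin_spanZ.
- move=> i; rewrite -scalerBr normrZ ger0_norm ?invr_ge0// exprMn exprVn mulrC.
  apply: ler_pM; rewrite ?invr_ge0 ?sqr_ge0//.
  by rewrite lef_pV2 ?posrE// (lt_le_trans d0).
Qed.

End inner_product.

(** * Indicators of initial segments *)

Section initial_segments.
Variable R : realType.

(** X_t, the class of the indicator of [0,t]. *)
Definition segchi (t : R) : L2_01 R := chi (@measurable_itv R `[0, t]).

(** Beyond 1, [t] has no effect on the class of the indicator, hence needs no
    upper bound here. *)
Lemma inner_segchi (s t : R) : 0 <= s <= 1 -> 0 <= t ->
  inner (segchi s) (segchi t) = Num.min s t.
Proof.
move=> /andP[s0 s1] t0.
have mI (r : R) : measurable_fun [set: measurableTypeR R]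
    (\1_(`[0, r]%classic) : measurableTypeR R -> R).
  exact: measurable_indic.
rewrite (inner_ae (mI s) (mI t) (chiE _) (chiE _)).
have -> : \int[lebesgue01 R]_x (\1_(`[0, s]%classic) x * \1_(`[0, t]%classic) x)
   = \int[lebesgue01 R]_x (\1_(`[0, Num.min s t]%classic) x).
  apply: eq_Rintegral => x _; rewrite !indicE -natrM mulnb -in_setI.
  congr (_ _)%:R.
  congr (_ \in _); apply/seteqP; split => y /=; rewrite !in_itv/= le_min.
    by move=> [/andP[-> ->] /andP[_ ->]].
  by move=> /andP[-> /andP[-> ->]].
rewrite /Rintegral integral_indic// setIT.
rewrite -[X in fine X]/(@lebesgue_measure R (_ `&` `[0, 1])).
rewrite setIidl; last first.
  move=> y /=; rewrite !in_itv/= le_min => /andP[-> /andP[ys _]].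
  exact: le_trans s1.
rewrite lebesgue_measure_itv/= lte_fin.
case: ifPn => [_|]; first by rewrite oppr0 -EFinD addr0.
by rewrite -leNgt => h; apply/eqP; rewrite eq_le h le_min s0 t0.
Qed.

Lemma norm_segchiB (s t : R) : 0 <= s <= 1 -> 0 <= t <= 1 ->
  `|segchi s - segchi t| ^+ 2 = `|s - t|.
Proof.
move=> /[dup] s01 /andP[s0 s1] /[dup] t01 /andP[t0 t1].
rewrite -inner_norm innerBl !innerBr !inner_segchi// !minxx (minC t).
have [st|st] := leP s t; first by rewrite ler0_norm; lra.
rewrite gtr0_norm; lra.
Qed.

Lemma segchi_increments_orthogonal (s1 s2 t1 t2 : R) :
  0 <= s1 -> s1 <= s2 -> s2 <= t1 -> t1 <= t2 -> t2 <= 1 ->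
  inner (segchi s2 - segchi s1) (segchi t2 - segchi t1) = 0.
Proof.
move=> ? ? ? ? ?; rewrite innerBl !innerBr !inner_segchi; try lra.
by rewrite !min_l; lra.
Qed.

(** The increments of X over n intervals of length at least [delta] form an
    orthogonal system; an approximation of the X_(s i) within [rho] approximates
    these increments within [2 * rho]. *)
Lemma segchi_span_dist n m (s : nat -> R) (b : 'I_m -> L2_01 R)
    (h : nat -> L2_01 R) (delta rho : R) : 0 < delta ->
  (forall i, (i <= n)%N -> 0 <= s i <= 1) ->
  (forall i j, (i < j <= n)%N -> s i + delta <= s j) ->
  (forall i, (i <= n)%N -> lin_span b (h i) /\ `|segchi (s i) - h i| <= rho) ->
  delta * (n%:R - m%:R) <= n%:R * (2 * rho) ^+ 2.
Proof.
move=> d0 s01 ss hb.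
have sle i j : (i <= j <= n)%N -> s i <= s j.
  rewrite leq_eqVlt => /andP[/orP[/eqP->//|ij jn]].
  by have := ss i j; rewrite ij jn => /(_ isT); lra.
have og (i j : nat) : (i < j < n)%N ->
    inner (segchi (s i.+1) - segchi (s i)) (segchi (s j.+1) - segchi (s j)) = 0.
  move=> /andP[ij jn]; apply: segchi_increments_orthogonal.
  - by have /andP[] := s01 _ (ltnW (ltn_trans ij jn)).
  - by apply: sle; rewrite leqnSn (ltn_trans ij jn).
  - by apply: sle; rewrite ij ltnW.
  - by apply: sle; rewrite leqnSn.
  - by have /andP[] := s01 _ jn.
apply: (@orthogonal_span_dist _ _ _ _ n m
  (fun i : 'I_n => segchi (s i.+1) - segchi (s i)) b
  (fun i : 'I_n => h i.+1 - h i)) => //.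
- move=> i j ij; have [lij|lji|eij] := ltngtP i j.
  + by apply: og; rewrite lij /=.
  + by rewrite innerC; apply: og; rewrite lji /=.
  + by rewrite (val_inj eij) eqxx in ij.
- move=> i; rewrite norm_segchiB; [|exact: s01|exact/s01/ltnW].
  have := ss i i.+1; rewrite ltnSn ltn_ord => /(_ isT) h1.
  by rewrite ger0_norm; lra.
- move=> i; apply: lin_spanB; first by have [] := hb i.+1 (ltn_ord _).
  by have [] := hb i (ltnW (ltn_ord _)).
- move=> i.
  have [_ h1] := hb i.+1 (ltn_ord _); have [_ h2] := hb i (ltnW (ltn_ord _)).
  rewrite ler_sqr ?nnegrE//; last first.
    by rewrite mulr_ge0// (le_trans _ h1).
  have -> : segchi (s i.+1) - segchi (s i) - (h i.+1 - h i) =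
     (segchi (s i.+1) - h i.+1) - (segchi (s i) - h i).
    by rewrite !opprD addrACA.
  rewrite [2 * rho]mulr_natl [rho *+ 2]mulr2n.
  by apply: le_trans (ler_normB _ _) _; exact: lerD.
Qed.

End initial_segments.

(** * A pigeonhole principle *)

Lemma pigeonhole_count (f : nat -> nat) (s : seq nat) (N q : nat) :
  (0 < N)%N -> (forall k, k \in s -> (f k < N)%N) -> (N * q <= size s)%N ->
  exists j, (q <= size [seq k <- s | f k == j])%N.
Proof.
move=> N0 fN sN; apply: contrapT => /forallNP nq.
have := sN; rewrite leqNgt => /negP; apply.
have -> : size s = (\sum_(j < N) size [seq k <- s | f k == j])%N.
  elim: s fN {sN nq} => [|k s IH] fN /=; first by rewrite big1.
  rewrite IH; last by move=> l ls; apply: fN; rewrite inE ls orbT.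
  have fk : (f k < N)%N by apply: fN; rewrite mem_head.
  rewrite (bigD1 (Ordinal fk))//= [in RHS](bigD1 (Ordinal fk))//= eqxx/= addSn.
  congr (_ + _).+1; apply: eq_bigr => j; rewrite -val_eqE/= eq_sym => /negbTE.
  by rewrite eq_sym; case: eqP.
case: q nq {sN} => [/(_ 0)//|q nq].
apply: (@leq_ltn_trans (N * q)%N); last by rewrite ltn_pmul2l.
rewrite -[X in (_ <= X * _)%N]card_ord -sum_nat_const; apply: leq_sum => j _.
by rewrite leqNgt; apply/negP; exact: nq.
Qed.

(** * Bounds on the width *)

Section widths.
Variable R : realType.

(** On the grid of mesh 1/K, minus the second difference of X at the point
    (k+1)/K pairs to 1/K with X_((k+1)/K) and to zero with the other
    X_((l+1)/K): with one argument fixed, min is piecewise affine with a single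
    kink. For [k = K.-1], the point (k+2)/K lies beyond 1, where [inner_segchi]
    still applies. *)
Lemma segchi_second_difference (K k l : nat) : (l < K)%N ->
  inner (segchi (l.+1%:R / K%:R : R))
     (2 *: segchi (k.+1%:R / K%:R) - segchi (k%:R / K%:R)
      - segchi (k.+2%:R / K%:R))
  = (l == k)%:R / K%:R.
Proof.
move=> lK; have K0 : 0 < K%:R :> R by rewrite ltr0n (leq_ltn_trans _ lK).
have Kr i : 0 <= i%:R / K%:R :> R by rewrite divr_ge0.
have h : 0 <= (l.+1%:R / K%:R : R) <= 1.
  by rewrite Kr ler_pdivrMr// mul1r ler_nat.
rewrite !innerBr innerZr !inner_segchi//.
have mE i j : Num.min (i%:R / K%:R) (j%:R / K%:R) = (minn i j)%:R / K%:R :> R.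
  rewrite -minr_pMl ?invr_ge0; last exact: ltW.
  congr (_ / _).
  have [ij|ij] := leqP i j; first by rewrite min_l ?ler_nat.
  by rewrite min_r// ler_nat ltnW.
rewrite !mE mulrA -!mulrBl; congr (_ / _).
have [lk|lk|->] := ltngtP l k.
- rewrite !(minn_idPl _) ?ltnS// ?(ltnW lk)//; last exact/ltnW/ltnW.
  by rewrite mulr0n; lra.
- rewrite !(minn_idPr _) ?(ltnW lk)//; [|exact/ltnW/leqW|exact: leqW].
  by rewrite mulr0n -!natr1; lra.
- by rewrite minnn (minn_idPr _)// (minn_idPl _)// mulr1n -!natr1; lra.
Qed.

(** The [j]-th group of [m] consecutive right endpoints of the cells of the grid
    of mesh 1/K. *)
Definition block (K m j : nat) (i : 'I_m) : L2_01 R :=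
  segchi ((j * m + i).+1%:R / K%:R).

Lemma block_lt N m j (i : 'I_m) : (j < N)%N -> (j * m + i < N * m)%N.
Proof.
move=> jN; rewrite (leq_trans (n := j * m + m))// ?ltn_add2l//.
by rewrite -mulSnr leq_mul2r jN orbT.
Qed.

(** The coefficients of a vanishing combination are read off by pairing it with
    second differences. *)
Lemma block_indep N m j : (j < N)%N -> lin_indep (@block (N * m) m j).
Proof.
move=> jN c c0 i.
pose K := (N * m)%N; pose k := (j * m + i)%N.
have kK : (k < K)%N by exact: block_lt.
have K0 : K%:R != 0 :> R by rewrite pnatr_eq0 -lt0n (leq_ltn_trans _ kK).
have := congr1 (fun F => inner F (2 *: segchi (k.+1%:R / K%:R) -
  segchi (k%:R / K%:R) - segchi (k.+2%:R / K%:R))) c0.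
rewrite inner0l inner_suml (bigD1 i)//= big1 => [|l li].
  rewrite segchi_second_difference// eqxx addr0 => /eqP.
  by rewrite !mulf_eq0 oner_eq0 invr_eq0 (negbTE K0) !orbF => /eqP.
rewrite segchi_second_difference; last exact: block_lt.
by rewrite eqn_add2l (inj_eq val_inj) (negbTE li) mul0r mulr0.
Qed.

(** The second difference at the first point of block [j] is orthogonal to every
    other block, but not to block [j] itself. *)
Lemma block_span_inj N m : (0 < m)%N ->
  {in `I_N &, injective (fun j => lin_span (@block (N * m) m j))}.
Proof.
move=> m0 j j'; rewrite !inE/= => jN j'N e.
pose i0 := Ordinal m0; pose K := (N * m)%N; pose k := (j * m)%N.
have kK : (k < K)%N by have := block_lt i0 jN; rewrite addn0.
have : lin_span (@block (N * m) m j) (block K j i0).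
  exact: lin_span_mem.
rewrite e => -[c _].
move=> /(congr1 (fun F => inner F (2 *: segchi (k.+1%:R / K%:R) -
  segchi (k%:R / K%:R) - segchi (k.+2%:R / K%:R)))).
rewrite inner_suml /block addn0 segchi_second_difference// eqxx => sE.
apply/eqP; apply: contraT => jj'.
have K0 : K%:R != 0 :> R by rewrite pnatr_eq0 -lt0n (leq_ltn_trans _ kK).
suff : (1%:R / K%:R : R) == 0.
  by rewrite mulf_eq0 oner_eq0 invr_eq0 (negbTE K0).
rewrite -sE; apply/eqP/big1 => i _.
rewrite segchi_second_difference; last exact: block_lt.
suff /negbTE -> : (j' * m + i)%N != k by rewrite mul0r mulr0.
apply: contra jj' => /eqP /(congr1 (divn^~ m)).
by rewrite /k /= divnMDl// divn_small ?addn0 ?mulnK// => ->.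
Qed.

Lemma grid_approx (K : nat) (t : R) : (0 < K)%N -> 0 <= t <= 1 ->
  exists2 k, (k < K)%N & `|t - k.+1%:R / K%:R| <= K%:R^-1.
Proof.
move=> K0 /andP[t0 t1]; have K0R : 0 < K%:R :> R by rewrite ltr0n.
(* At [t = 1], [truncn (t * K)] would be [K], one more than the last index. *)
have [t1'|] := ltP t 1; last first.
  move=> t1'; exists K.-1; rewrite ?ltn_predL// prednK// divff ?gt_eqF//.
  by have -> : t = 1; [lra|rewrite subrr normr0 invr_ge0 ltW].
have /truncn_itv/andP[h1 h2] : 0 <= t * K%:R by rewrite mulr_ge0.
exists (Num.truncn (t * K%:R)).
  by rewrite -(ltr_nat R) (le_lt_trans h1)// gtr_pMl.
set k := Num.truncn _ in h1 h2 *.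
have -> : t - k.+1%:R / K%:R = - (k.+1%:R - t * K%:R) / K%:R.
  by field; rewrite gt_eqF.
have Ki : 0 <= K%:R^-1 :> R by rewrite invr_ge0 ltW.
rewrite normrM normrN (ger0_norm Ki) ler_piMl//.
rewrite ger0_norm ?subr_ge0; last exact: ltW.
by rewrite -natr1; lra.
Qed.

Lemma width_le (N m : nat) : (0 < N)%N -> (0 < m)%N ->
  (temlyakov_width N m (@initial_segment_indicators R)
    <= (Num.sqrt (N * m)%:R)^-1%:E)%E.
Proof.
move=> N0 m0; set K := (N * m)%N.
have K0 : (0 < K)%N by rewrite muln_gt0 N0.
pose LN := [set lin_span (@block K m j) | j in `I_N].
apply: (@le_trans _ _ (ereal_sup [set ereal_inf [set edist_inf L f | L in LN]
    | f in @initial_segment_indicators R])).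
  apply: ereal_inf_lbound; exists LN => //; split.
    by move=> _ [j jN <-]; exists (@block K m j) => //; exact: block_indep.
  exact/inj_card_eq/block_span_inj.
apply: ge_ereal_sup => _ [_ [t t01 <-] <-].
have {}t01 : 0 <= t <= 1 by move: t01; rewrite /= in_itv.
have [k kK tk] := grid_approx K0 t01.
have jN : (k %/ m < N)%N by rewrite ltn_divLR.
apply: ge_ereal_inf.
exists (edist_inf (lin_span (@block K m (k %/ m))) (segchi t)).
  by exists (lin_span (@block K m (k %/ m))) => //; exists (k %/ m)%N.
rewrite edist_infE; apply: ge_ereal_inf.
pose i := Ordinal (ltn_pmod k m0).
have kE : (k %/ m * m + i)%N = k by rewrite -divn_eq.
exists (`|segchi t - segchi (k.+1%:R / K%:R)|%:E).
  exists (segchi (k.+1%:R / K%:R)) => //.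
  by have := lin_span_mem (@block K m (k %/ m)) i; rewrite /block kE.
rewrite lee_fin -sqrtrV ?ler0n// -[leLHS]ger0_norm// -sqrtr_sqr ler_wsqrtr//.
rewrite norm_segchiB//; apply/andP; split; first by rewrite divr_ge0.
by rewrite ler_pdivrMr ?ltr0n// mul1r ler_nat.
Qed.

Lemma width_ge (N m : nat) (rho : R) : (0 < N)%N -> (0 < m)%N -> 0 < rho ->
  24 * rho ^+ 2 * (N * m)%:R < 1 ->
  (rho%:E <= temlyakov_width N m (@initial_segment_indicators R))%E.
Proof.
move=> N0 m0 rho0 rhoNm.
apply: le_ereal_inf_tmp => _ [LN [LNm LNN] <-].
rewrite leNgt; apply/negP => sup_lt.
pose K := (N * (3 * m))%N.
have K0 : (0 < K)%N by rewrite !muln_gt0 N0 m0.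
have K0R : 0 < K%:R :> R by rewrite ltr0n.
pose t (k : nat) : R := k%:R / K%:R.
have t01 k : (k < K)%N -> 0 <= t k <= 1.
  by move=> kK; rewrite divr_ge0//= ler_pdivrMr// mul1r ler_nat ltnW.
have near k : exists p : set (L2_01 R) * L2_01 R, (k < K)%N ->
    [/\ LN p.1, p.1 p.2 & `|segchi (t k) - p.2| <= rho].
  have [kK|_] := boolP (k < K)%N; last by exists (set0, 0).
  have : (ereal_inf [set edist_inf L (segchi (t k)) | L in LN] < rho%:E)%E.
    apply: le_lt_trans sup_lt; apply: ereal_sup_ubound.
    by exists (segchi (t k)) => //; exists (t k) => //; rewrite /= in_itv/= t01.
  move=> /ereal_inf_lt[_ [L LNL <-]]; rewrite edist_infE.
  move=> /ereal_inf_lt[_ [g Lg <-]]; rewrite lte_fin => /ltW gt.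
  by exists (L, g).
(* [p k] is a subspace of the family with a point of it near X_(t k). *)
have {near}[p pP] := choice near.
(* [phi] numbers the subspaces, and [f k] is the number of [(p k).1]. *)
have /card_set_bijP[phi [phiN phiI _]] := LNN.
pose f k := phi (p k).1.
have fN k : k \in iota 0 K -> (f k < N)%N.
  by rewrite mem_iota => /= kK; have [Lk _ _] := pP _ kK; exact: phiN.
have [|j sj] := @pigeonhole_count f (iota 0 K) N (3 * m) N0 fN.
  by rewrite size_iota.
(* The increasing list of the indices [k] that share the subspace number [j]. *)
set s := [seq k <- _ | _] in sj.
have sK k : k \in s -> (k < K)%N /\ f k = j.
  by rewrite mem_filter mem_iota => /andP[/eqP].
have s_lt : sorted ltn s.
  by apply: sorted_filter; [exact: ltn_trans|exact: iota_ltn_sorted].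
pose n := (2 * m)%N.
have ns i : (i <= n)%N -> (i < size s)%N.
  by move=> iN; apply: leq_trans sj; rewrite (leq_ltn_trans iN)// ltn_pmul2r.
have sP i : (i <= n)%N -> (nth 0 s i < K)%N /\ f (nth 0 s i) = j.
  by move=> /ns iN; exact/sK/mem_nth.
have [s0K fs0] := sP 0 (leq0n _).
have [L0 _ _] := pP _ s0K.
have [b _ bL] := LNm _ L0.
have := @segchi_span_dist R n m (fun i => t (nth 0 s i)) b
  (fun i => (p (nth 0 s i)).2) K%:R^-1 rho.
rewrite invr_gt0 K0R => /(_ isT) H.
have {H} : K%:R^-1 * (n%:R - m%:R) <= n%:R * (2 * rho) ^+ 2.
  apply: H.
  - by move=> i /sP[iK _]; exact: t01.
  - move=> i i' /andP[ii' i'n].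
    have lt_s : (nth 0 s i < nth 0 s i')%N.
      apply: (sorted_ltn_nth ltn_trans 0 s_lt) => //; rewrite inE ns//.
      exact: leq_trans (ltnW ii') i'n.
    by rewrite /t -[X in _ + X]mul1r -mulrDl ler_pM2r ?invr_gt0// natr1 ler_nat.
  - move=> i /sP[iK fi]; have [Li pi ti] := pP _ iK; split => //.
    rewrite -bL; suff -> : (p (nth 0 s 0)).1 = (p (nth 0 s i)).1 by [].
    by apply: phiI; rewrite ?inE//; rewrite -/(f _) fs0 -fi.
rewrite leNgt => /negP; apply.
rewrite [ltRHS]mulrC ltr_pdivlMr//.
have -> : n%:R = 2 * m%:R :> R by rewrite natrM.
have -> : K%:R = 3 * (N * m)%:R :> R by rewrite -natrM mulnCA.
have m0R : 0 < m%:R :> R by rewrite ltr0n.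
have : m%:R * (24 * rho ^+ 2 * (N * m)%:R) < m%:R * 1 by rewrite ltr_pM2l.
lra.
Qed.

End widths.

Unset Implicit Arguments.

Theorem proposition2p16 (R : realType) :
  exists C1 C2 : R, [/\ 0 < C1, 0 < C2 &
    forall N m : nat, (1 <= N)%N -> (1 <= m)%N ->
      ((C1 / Num.sqrt (N * m)%:R)%:E
         <= temlyakov_width N m (@initial_segment_indicators R))%E /\
      (temlyakov_width N m (@initial_segment_indicators R)
         <= (C2 / Num.sqrt (N * m)%:R)%:E)%E].
Proof.
(* [width_ge] requires 24 * C1^2 < 1, which C1 = 1/5 satisfies. *)
exists (5^-1), 1; split => // N m N0 m0; split; last first.
  by rewrite div1r; exact: width_le.
have K0 : 0 < (N * m)%:R :> R by rewrite ltr0n muln_gt0 N0.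
apply: width_ge => //; first by rewrite divr_gt0// sqrtr_gt0.
rewrite exprMn !exprVn sqr_sqrtr; last exact: ltW.
rewrite mulrA divfK ?gt_eqF//; lra.
Qed.
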